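(* Let $(M,d)$ be the countable metric space defined in the context. Let $K$ be a compact Hausdorff space, let $X=C(K)$, and assume that there exist $D\in[1,2)$ and a map $f:M\to X$ such that $$d(x,y)\le \|f(x)-f(y)\|\le D\,d(x,y)\qquad\text{for all }x,y\in M.$$ Then $K$ is not scattered.
   Context: $\mathbb N=\{1,2,3,\dots\}$. The metric space $(M,d)$: let $F=\{A\subset\mathbb N: 1\le |A|<\infty\}$ be the set of all finite nonempty subsets of $\mathbb N$, and let $M=\{\emptyset\}\cup\mathbb N\cup F$ (the three pieces are regarded as pairwise disjoint). Make $M$ into a graph by putting an edge between $\emptyset$ and every $n\in\mathbb N$, and an edge between $n\in\mathbb N$ and $A\in F$ exactly when $n\in A$; there are no other edges. The metric $d$ is the shortest path metric of this graph. Explicitly, for $n\ne m$ in $\mathbb N$ and $A\neq B$ in $F$: $d(\emptyset,n)=1$; $d(n,m)=2$; $d(n,A)=1$ if $n\in A$ and $d(n,A)=3$ if $n\notin A$; $d(\emptyset,A)=2$; $d(A,B)=2$ if $A\cap B\ne\emptyset$ and $d(A,B)=4$ if $A\cap B=\emptyset$. $C(K)$ is the Banach space of continuous scalar functions on $K$ with the supremum norm. A compact Hausdorff space $K$ is called scattered if there is an ordinal $\alpha$ such that the Cantor–Bendixson derivative $K^{(\alpha)}$ is empty. *)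

(* Defs.v *)
From HB Require Import structures.
From mathcomp Require Import all_boot all_order all_algebra finmap.
From mathcomp Require Import all_classical all_reals all_analysis.
From mathcomp Require Import complex.
From mathcomp Require wochoice.

Set Implicit Arguments.
Unset Strict Implicit.
Unset Printing Implicit Defensive.

Import Order.TTheory GRing.Theory Num.Theory.
Import numFieldNormedType.Exports.

Local Open Scope classical_set_scope.
Local Open Scope ring_scope.

Definition pnat : Type := {n : nat | (0 < n)%N}.

Definition finpart : Type := {A : {fset pnat} | A != fset0}.

(* Empty is the vertex \emptyset; Pt n and Fin A are the copies of n in N and of
   the finite nonempty set A; keeping them as separate constructors makes the
   three pieces disjoint. *)
Variant M : Type := Empty | Pt of pnat | Fin of finpart.

Definition edge (x y : M) : bool :=
  match x, y with
  | Empty, Pt _ | Pt _, Empty => true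
  | Pt n, Fin A | Fin A, Pt n => n \in val A
  | _, _ => false
  end.

Definition walk (x y : M) (n : nat) : Prop :=
  exists p : seq M, [/\ size p = n, path edge x p & last x p = y].

Lemma walk_cat x y z m n : walk x y m -> walk y z n -> walk x z (m + n).
Proof.
move=> [p [<- xp py]] [q [<- yq qz]]; exists (p ++ q).
by rewrite size_cat cat_path last_cat py xp yq qz.
Qed.

Lemma edge_walk x y : edge x y -> walk x y 1.
Proof. by move=> xy; exists [:: y]; rewrite /= xy. Qed.

Lemma edgeC x y : edge x y = edge y x.
Proof. by case: x y => [|n|A] [|m|B]. Qed.

Lemma Fin_neighbor (A : finpart) : exists n, n \in val A.
Proof. by have /fset0Pn[n nA] := valP A; exists n. Qed.

Lemma walk_to_Empty x : exists n, walk x Empty n.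
Proof.
case: x => [|n|A]; first by exists 0%N, [::].
  by exists 1%N; exact: edge_walk.
have [n nA] := Fin_neighbor A; exists (1 + 1)%N.
by apply: (@walk_cat _ (Pt n)); exact: edge_walk.
Qed.

Lemma walk_from_Empty y : exists n, walk Empty y n.
Proof.
case: y => [|n|A]; first by exists 0%N, [::].
  by exists 1%N; exact: edge_walk.
have [n nA] := Fin_neighbor A; exists (1 + 1)%N.
by apply: (@walk_cat _ (Pt n)); exact: edge_walk.
Qed.

Lemma connected x y : exists n, `[< walk x y n >].
Proof.
have [m xm] := walk_to_Empty x; have [n yn] := walk_from_Empty y.
by exists (m + n)%N; apply/asboolP; exact: walk_cat xm yn.
Qed.

Definition dist (x y : M) : nat := ex_minn (connected x y).

Definition dist_formula (x y : M) : nat :=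
  match x, y with
  | Empty, Empty => 0
  | Empty, Pt _ | Pt _, Empty => 1
  | Empty, Fin _ | Fin _, Empty => 2
  | Pt n, Pt m => if n == m then 0 else 2
  | Pt n, Fin A | Fin A, Pt n => if n \in val A then 1 else 3
  | Fin A, Fin B => if A == B then 0 else
                    if (val A `&` val B == fset0)%fset then 4 else 2
  end.

Lemma dist_formula_walk x y : walk x y (dist_formula x y).
Proof.
have EP n : walk Empty (Pt n) 1 by exact: edge_walk.
have PE n : walk (Pt n) Empty 1 by exact: edge_walk.
have FE A : walk (Fin A) Empty 2.
  have [n nA] := Fin_neighbor A.
  by apply: (@walk_cat _ (Pt n) _ 1 1); exact: edge_walk.
have EF A : walk Empty (Fin A) 2.
  have [n nA] := Fin_neighbor A.
  by apply: (@walk_cat _ (Pt n) _ 1 1); exact: edge_walk.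
case: x y => [|n|A] [|m|B] //=; first by exists [::].
- case: eqP => [->|_]; first by exists [::].
  exact: (walk_cat (PE n) (EP m)).
- by case: ifP => [?|_]; [exact: edge_walk|exact: (walk_cat (PE n) (EF B))].
- by case: ifP => [?|_]; [exact: edge_walk|exact: (walk_cat (FE A) (EP m))].
- case: eqP => [->|_]; first by exists [::].
  case: ifPn => [_|/fset0Pn[n]]; first exact: (walk_cat (FE A) (EF B)).
  rewrite inE => /andP[nA nB].
  by apply: (@walk_cat _ (Pt n) _ 1 1); exact: edge_walk.
Qed.

Lemma dist_formula_edge x y z :
  edge x y -> (dist_formula x z <= (dist_formula y z).+1)%N.
Proof.
case: x y z => [|n|A] [|m|B] [|k|C] //= h; try by do ?case: ifPn.
- case: (eqVneq B C) => [<-|_]; first by rewrite h.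
  by do ?case: ifPn.
- case: (eqVneq m k) => [<-|_]; first by rewrite h.
  by case: ifPn.
- case: (eqVneq A C) => // _; case: ifPn => [/eqP/fsetP/(_ m)|_].
    by rewrite !inE h /= => ->.
  by case: ifPn.
Qed.

Lemma dist_formulaxx x : dist_formula x x = 0%N.
Proof. by case: x => [|n|A] /=; rewrite ?eqxx. Qed.

Lemma distE x y : dist x y = dist_formula x y.
Proof.
rewrite /dist; case: ex_minnP => n /asboolP[p [<- xp py]] nmin.
apply/eqP; rewrite eqn_leq nmin ?andTb; last first.
  by apply/asboolP; exact: dist_formula_walk.
elim: p x xp py {nmin} => [x _ /= ->|z p IH x /= /andP[xz zp] py].
  by rewrite dist_formulaxx.
apply: leq_trans (dist_formula_edge _ xz) _; rewrite ltnS; exact: IH.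
Qed.

(* [Rcomplex R] is R[i] seen as a vector space over R, with the modulus
   (valued in R) as norm; it is given the corresponding topology. *)
Section Rcomplex_normedModType.
Variable R : realType.

Lemma Rcomplex_normrZ (l : R) (x : Rcomplex R) : `|l *: x| = `|l| * `|x|.
Proof.
case: x => a b; rewrite /Num.norm /= !exprMn -mulrDr sqrtrM ?sqr_ge0//.
by rewrite sqrtr_sqr.
Qed.

HB.instance Definition _ :=
  PseudoMetric.copy (Rcomplex R) (pseudoMetric_normed (Rcomplex R)).
HB.instance Definition _ := isPointed.Build (Rcomplex R) 0.
HB.instance Definition _ :=
  NormedZmod_PseudoMetric_eq.Build R (Rcomplex R) erefl.
HB.instance Definition _ :=
  PseudoMetricNormedZmod_Lmodule_isNormedModule.Build R (Rcomplex R)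
    Rcomplex_normrZ.

End Rcomplex_normedModType.

(* The scalars are either the real or the complex numbers. *)
Variant scalars : Type := RealScalars | ComplexScalars.

Definition scalar_field (R : realType) (s : scalars) : normedModType R :=
  match s with
  | RealScalars => R^o
  | ComplexScalars => Rcomplex R
  end.

(* The set of norms is bounded when g is continuous and K is compact, see
   [supnorm_has_ubound]; the supremum of the empty set is 0. *)
Definition supnorm (R : realType) (V : normedModType R) (K : topologicalType)
  (g : K -> V) : R := sup [set `|g t| | t in [set: K]].

Lemma supnorm_has_ubound (R : realType) (V : normedModType R)
    (K : topologicalType) (g : K -> V) :
  compact [set: K] -> continuous g ->
  has_ubound [set `|g t| | t in [set: K]].
Proof.
move=> cK cg; have : compact [set `|g t| | t in [set: K]].
  apply: continuous_compact => //; apply: continuous_subspaceT => t.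
  by apply: continuous_comp; [exact: cg|exact: norm_continuous].
move=> /compact_bounded[N [_ /(_ (N + 1))]]; rewrite ltrDl => /(_ ltr01) h.
by exists (N + 1) => _ [t _ <-]; apply: le_trans (ler_norm _) (h _ _); exists t.
Qed.

Lemma le_supnorm (R : realType) (V : normedModType R)
    (K : topologicalType) (g : K -> V) (t : K) :
  compact [set: K] -> continuous g -> `|g t| <= supnorm g.
Proof.
move=> cK cg; apply: ub_le_sup; first exact: supnorm_has_ubound.
by exists t.
Qed.

Definition CB_derivative (K : topologicalType) (A : set K) : set K :=
  A `\` isolated A.

(* An ordinal is represented by a position in a well-ordered type (W, le). *)
Section Ordinals.
Variables (W : eqType) (le : rel W).

Definition wo_lt (a b : W) : bool := le a b && (a != b).

Definition is_zero (a : W) : Prop := forall b, ~~ wo_lt b a.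

(* b is the successor of a *)
Definition is_succ (a b : W) : Prop :=
  wo_lt a b /\ forall c, wo_lt a c -> le b c.

Definition is_limit (b : W) : Prop :=
  ~ is_zero b /\ forall a, ~ is_succ a b.

(* D a = K^(a) for all positions a *)
Definition CB_hierarchy (K : topologicalType) (D : W -> set K) : Prop :=
  [/\ forall a, is_zero a -> D a = [set: K],
      forall a b, is_succ a b -> D b = CB_derivative (D a) &
      forall b, is_limit b -> D b = \bigcap_(a in [set a | wo_lt a b]) D a].

End Ordinals.

(* Every ordinal is the order type of the positions strictly below some position
   of some well-order, and the hierarchy along a well-order exists and is unique
   ([CB_hierarchy_exists_unique]), so this says that K^(alpha) is empty for some
   ordinal alpha. *)
Definition scattered (K : topologicalType) : Prop :=
  exists (W : eqType) (le : rel W) (D : W -> set K),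
    [/\ wochoice.well_order le, CB_hierarchy le D & exists a, D a = set0].

Section CB_hierarchy_theory.
Variables (W : eqType) (le : rel W).
Hypothesis le_wo : wochoice.well_order le.

Lemma wo_le_refl a : le a a.
Proof.
have [|z [[/eqP-> zmin] _]] := le_wo (A := pred1 a).
  by exists a; exact/eqP.
by apply: zmin; exact/eqP.
Qed.

Lemma wo_le_anti a b : le a b -> le b a -> a = b.
Proof.
move=> ab ba; have [|z [_ zuniq]] := le_wo (A := pred2 a b).
  by exists a; rewrite inE eqxx.
rewrite -(zuniq a); last first.
  split=> [|c]; first by rewrite inE eqxx.
  by rewrite inE => /orP[] /eqP-> //; exact: wo_le_refl.
apply: zuniq; split=> [|c]; first by rewrite inE eqxx orbT.
by rewrite inE => /orP[] /eqP-> //; exact: wo_le_refl.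
Qed.

Lemma wo_lt_wf : well_founded (wo_lt le).
Proof.
move=> a; apply: contrapT => na.
have [|z [[+ zmin] _]] := le_wo (A := [pred x | `[< ~ Acc (wo_lt le) x >]]).
  by exists a; exact/asboolP.
move=> /asboolP; apply; constructor => b /andP[bz].
apply: contra_neqP => nb; apply: wo_le_anti bz _.
by apply: zmin; exact/asboolP.
Qed.

Lemma is_succ_inj a a' b : is_succ le a b -> is_succ le a' b -> a = a'.
Proof.
move=> [ab amin] [a'b a'min].
have total c d : le c d || le d c.
  have [|z [[+ zmin] _]] := le_wo (A := pred2 c d).
    by exists c; rewrite inE eqxx.
  rewrite inE => /orP[] /eqP zE; subst z.
    by rewrite zmin// inE eqxx orbT.
  by rewrite (zmin c) ?orbT// inE eqxx.
apply/eqP; apply: contraT => aa'; have /orP[le_aa'|le_a'a] := total a a'.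
  have /amin ba' : wo_lt le a a' by rewrite /wo_lt le_aa' aa'.
  by move: a'b => /andP[/wo_le_anti/(_ ba') ->]; rewrite eqxx.
have /a'min ba : wo_lt le a' a by rewrite /wo_lt le_a'a eq_sym aa'.
by move: ab => /andP[/wo_le_anti/(_ ba) ->]; rewrite eqxx.
Qed.

Lemma CB_hierarchy_exists_unique (K : topologicalType) :
  exists! D : W -> set K, CB_hierarchy le D.
Proof.
pose step (b : W) (D : forall a, wo_lt le a b -> set K) : set K :=
  [set x | (forall a (ab : wo_lt le a b), is_succ le a b ->
              CB_derivative (D a ab) x) /\
           (is_limit le b -> forall a (ab : wo_lt le a b), D a ab x)].
pose D := Fix wo_lt_wf (fun=> set K) step.
have DE b : D b = step b (fun a _ => D a).
  apply: (@Fix_eq _ _ wo_lt_wf (fun=> set K) step) => {}b f g fg.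
  rewrite (_ : f = g)//.
  by apply: functional_extensionality_dep => a; apply/funext => ab.
exists D; split=> [|D' [D'0 D'S D'L]].
  split=> [a a0|a b ab|b bl]; rewrite DE /step; apply/seteqP; split=> // x /=.
  - move=> _; split=> [b ba|[/(_ a0)//]].
    by move: (a0 b); rewrite ba.
  - by move=> [/(_ _ (proj1 ab) ab)].
  - move=> xD; split=> [c cb csb|[_ /(_ _ ab)]//].
    by rewrite (is_succ_inj csb ab).
  - by move=> [_ /(_ bl) h] a ab; exact: h.
  - move=> h; split=> [a ab asb|_ a ab]; last exact: h.
    by have := bl.2 _ asb.
apply/funext => b; elim/(well_founded_ind wo_lt_wf): b => b IH.
have [[a ab]|nsucc] := pselect (exists a, is_succ le a b).
  rewrite (D'S _ _ ab) -IH; last exact: ab.1.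
  rewrite DE /step; apply/seteqP; split=> x /=.
    by move=> [/(_ _ (proj1 ab) ab)].
  move=> xD; split=> [c cb csb|[_ /(_ _ ab)]//].
  by rewrite (is_succ_inj csb ab).
have [b0|nb0] := pselect (is_zero le b).
  rewrite (D'0 _ b0) DE; apply/seteqP; split=> // x _; split=> [a ab|[/(_ b0)//]].
  by move: (b0 a); rewrite ab.
have bl : is_limit le b by split=> // a ab; apply: nsucc; exists a.
rewrite (D'L _ bl) DE; apply/seteqP; split=> x /=.
  by move=> [_ /(_ bl) h] a ab; rewrite -IH//; exact: h.
move=> h; split=> [a ab asb|_ a ab]; first by have := bl.2 _ asb.
by rewrite IH//; exact: h.
Qed.

End CB_hierarchy_theory.

(* Main.v *)
Require Import Defs.
From mathcomp Require Import all_boot all_order all_algebra finmap.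
From mathcomp Require Import all_classical all_reals all_analysis.
From mathcomp Require Import complex lra.

Set Implicit Arguments.
Unset Strict Implicit.
Unset Printing Implicit Defensive.

Import Order.TTheory GRing.Theory Num.Theory.
Import numFieldNormedType.Exports.

Local Open Scope classical_set_scope.
Local Open Scope ring_scope.

(* Put g_n = f(n) - f(empty). For disjoint finite A and B there is a point t
   of K at which the values g_n(t), n in A, are at distance at least 2 - D
   from the values g_m(t), m in B; by compactness the same holds for every set
   A of indices and its complement, at some point t_A. As the g_n(t) stay in a
   ball of radius D, which is cut into finitely many cells of diameter less
   than 2 - D, the set A is determined by the sequence (g_n(t_A))_n and a set
   of cells. Hence t |-> (g_n(t))_n takes uncountably many values, whereas on
   a scattered compact space it takes countably many: the points all of whose
   neighborhoods have uncountable image form a set without isolated points. *)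

(** * Scattered compact spaces and countable images *)

(** By transfinite induction, a set without isolated points survives every derivative: a point of
    [B] isolated in a larger set would be isolated in [B]. *)
Lemma scattered_isolated (K : topologicalType) (B : set K) :
  scattered K -> B !=set0 -> isolated B !=set0.
Proof.
move=> [W [le [D [le_wo [D0 DS DL] [a Da]]]]] [x Bx].
apply: contrapT => B0.
suff BD b : B `<=` D b by have := BD a x Bx; rewrite Da.
elim/(well_founded_ind (wo_lt_wf le_wo)): b => b IH.
have [/D0->//|nb0] := pselect (is_zero le b).
have [[c cb]|nsucc] := pselect (exists c, is_succ le c b); last first.
  rewrite DL; last by split=> // c cb; apply: nsucc; exists c.
  by move=> y By c cb; exact: IH.
rewrite (DS _ _ cb) => y By; split; first exact: (IH c cb.1).
move=> [_ [V Vy VD]]; apply: B0; exists y; split; first exact: mem_set.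
exists V => //; apply/seteqP; split=> [z [Vz Bz]|_ ->].
  by rewrite -VD; split=> //; exact: (IH c cb.1).
by split=> //; exact: nbhs_singleton.
Qed.

(** The sets that cover [C] up to a part with countable image form a proper filter; [x] is one of
    its cluster points. *)
Lemma uncountable_image_cluster (K : topologicalType) T (phi : K -> T)
    (C : set K) : compact C -> ~ countable (phi @` C) ->
  exists2 x, C x & forall U, nbhs x U -> ~ countable (phi @` (C `&` U)).
Proof.
move=> cC nC; pose F := [set X : set K | countable (phi @` (C `\` X))].
have FF : ProperFilter F.
  split; first by rewrite /F /= setD0.
  split=> [|P Q FP FQ|P Q PQ].
  - by rewrite /F /= setDT image_set0; exact: countable0.
  - rewrite /F /= setDIr image_setU -bigcup2inE.
    by apply: bigcup_countable => // -[|[|i]] _ //=.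
  - apply: sub_countable; apply: subset_card_le; apply: image_subset.
    exact: setDS.
have FC : F C by rewrite /F /= setDv image_set0; exact: countable0.
have [x [Cx xF]] := cC F FF FC; exists x => // U Ux cU.
have FU : F (~` U) by rewrite /F /= setDE setCK.
by have [y []] := xF _ _ FU Ux.
Qed.

Lemma scattered_countable_image (R : realType) (V : normedModType R)
    (K : topologicalType) (I : countType) (g : I -> K -> V) :
  compact [set: K] -> hausdorff_space K -> scattered K ->
  (forall i, continuous (g i)) ->
  countable [set (fun i => g i t) | t in [set: K]].
Proof.
move=> cK hK sK cg; pose phi (t : K) := fun i => g i t; apply: contrapT => nK.
pose B := [set x : K | forall U, nbhs x U -> ~ countable (phi @` U)].
have clusterB C : compact C -> ~ countable (phi @` C) -> (C `&` B) !=set0.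
  move=> cC /(uncountable_image_cluster cC)[x Cx xC]; exists x; split=> // U Ux.
  apply: contra_not (xC _ Ux); apply: sub_countable; apply: subset_card_le.
  by apply: image_subset => ? [].
have [|x] := scattered_isolated sK (B := B).
  by have [x [_ Bx]] := clusterB _ cK nK; exists x.
move=> [/set_mem Bx [U Ux UB]].
(* By regularity [closure W] lies in [U], so it meets [B] at most in [x]. *)
have [W Wx WU] := compact_regular hK cK (@filterT _ (nbhs x) _) Ux.
have cW : countable (phi @` closure W); last first.
  apply: (Bx (closure W)) => //.
  by apply: filterS Wx; exact: subset_closure.
(* These compact sets miss [x], hence [B], so each has countable image; together they contain every
   point of [closure W] where [phi] differs from [phi x]. *)
pose S (p : I * nat) :=
  closure W `&` [set t | p.2.+1%:R^-1 <= `|g p.1 t - g p.1 x|].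
have cS p : countable (phi @` S p).
  apply: contrapT => /clusterB[|y [[Wy Sy] By]].
    apply: (subclosed_compact _ cK) => //; apply: closedI.
      exact: closed_closure.
    apply: (@preimage_closed _ _ (fun t => `|g p.1 t - g p.1 x|)
      [set r | p.2.+1%:R^-1 <= r]).
      move=> t _; apply: cvg_norm; apply: cvgB; [exact: cg|exact: cvg_cst].
    exact: closed_ge.
  have yx : [set x] y by rewrite -UB; split=> //; exact: WU.
  by move: Sy => /=; rewrite yx subrr normr0 leNgt invr_gt0 ltr0Sn.
have : phi @` closure W `<=` [set phi x] `|` \bigcup_p (phi @` S p).
  move=> _ [t Wt <-]; have [->|tx] := pselect (phi t = phi x); first by left.
  have /existsNP[i /eqP] : ~ forall i, g i t = g i x.
    by move=> tx'; apply: tx; apply/funext.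
  rewrite -subr_eq0 -normr_gt0 => gi; right.
  exists (i, Num.truncn `|g i t - g i x|^-1) => //; exists t => //; split=> //=.
  rewrite invf_ple ?posrE ?ltr0Sn//.
  by have [|_ /ltW] := andP (truncn_itv (x := `|g i t - g i x|^-1) _).
move=> /subset_card_le/sub_countable; apply.
rewrite -bigcup2inE; apply: bigcup_countable => // -[|[|i]] _ //=.
exact: bigcup_countable.
Qed.

(** * Counting sequences by cells *)

Lemma no_powerset_injection (e : set nat -> nat) : ~ injective e.
Proof.
move=> e_inj; pose A := [set n | exists2 X, e X = n & ~ X n].
have nA : ~ A (e A) by move=> /[dup] AA [X /e_inj -> nX].
by apply: (nA); exists A.
Qed.

Lemma real_cells (R : realType) (r d : R) : 0 < d ->
  exists (T : finType) (c : R -> T),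
    forall x y, `|x| <= r -> `|y| <= r -> c x = c y -> `|x - y| < d.
Proof.
move=> d0; pose k (x : R) := Num.truncn ((x + r) / d).
(* The cells are half-open intervals of length [d] starting at [- r]; [inord] is faithful on the
   ball, where [k] stays within the bound. *)
exists 'I_(Num.truncn ((r + r) / d)).+1, (fun x => inord (k x)) => x y.
have kP z : `|z| <= r ->
    (k z <= Num.truncn ((r + r) / d))%N /\
    (k z)%:R <= (z + r) / d < (k z).+1%:R.
  rewrite ler_norml => /andP[z1 z2]; split.
    by apply: le_truncn; rewrite ler_pM2r ?invr_gt0// lerD2r.
  by apply: truncn_itv; rewrite divr_ge0 ?(ltW d0)//; lra.
move=> /kP[kx /andP[x1 x2]] /kP[ky /andP[y1 y2]] /(congr1 val) /=.
rewrite !inordK// => kxy; rewrite kxy in x1 x2.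
rewrite -(ltr_pM2r (x := d^-1)) ?invr_gt0// divff ?gt_eqF//.
rewrite -[d^-1]gtr0_norm ?invr_gt0// -normrM mulrBl.
rewrite (_ : _ - _ = (x + r) / d - (y + r) / d); last first.
  by rewrite -!mulrBl opprD addrACA subrr addr0.
rewrite -natr1 in x2 y2.
by rewrite ltr_norml ltrBDl ltrBlDr; apply/andP; split; lra.
Qed.

Lemma scalar_cells (R : realType) (s : scalars) (r d : R) : 0 < d ->
  exists (T : finType) (c : scalar_field R s -> T),
    forall x y, `|x| <= r -> `|y| <= r -> c x = c y -> `|x - y| < d.
Proof.
case: s => d0; first exact: real_cells.
have d20 : 0 < d / 2 by rewrite divr_gt0.
have [T [c cP]] := real_cells r d20.
exists (T * T)%type,
  (fun z : Rcomplex R => (c (complex.Re z), c (complex.Im z))).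
have ReP (z : Rcomplex R) : `|complex.Re z| <= `|z|.
  case: z => a b; rewrite {2}/Num.norm /= -sqrtr_sqr ler_wsqrtr//.
  by rewrite lerDl sqr_ge0.
have ImP (z : Rcomplex R) : `|complex.Im z| <= `|z|.
  case: z => a b; rewrite {2}/Num.norm /= -sqrtr_sqr ler_wsqrtr//.
  by rewrite lerDr sqr_ge0.
have leP (z : Rcomplex R) : `|z| <= `|complex.Re z| + `|complex.Im z|.
  case: z => a b; rewrite {1}/Num.norm /=.
  rewrite -[leRHS]ger0_norm ?addr_ge0// -sqrtr_sqr ler_wsqrtr//.
  by rewrite sqrrD !real_normK ?num_real// lerD2r lerDl mulrn_wge0// mulr_ge0.
move=> x y xr yr [cRe cIm]; rewrite [d]splitr.
apply: le_lt_trans (leP _) _; apply: ltrD.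
  have := cP _ _ (le_trans (ReP x) xr) (le_trans (ReP y) yr) cRe.
  by case: x y {xr yr cRe cIm} => a b [a' b'].
have := cP _ _ (le_trans (ImP x) xr) (le_trans (ImP y) yr) cIm.
by case: x y {xr yr cRe cIm} => a b [a' b'].
Qed.

(** Suppose [A] and [B] yield the same sequence and the same cells. If [n] is in [A] but not in [B],
    its value at [t B] shares a cell with that of some [m] in [B], against the separation at
    [t B]. *)
Lemma independent_uncountable_range (R : realType) (V : normedModType R)
    (K : Type) (g : nat -> K -> V) (r d : R) (T : finType) (c : V -> T) :
  (forall n t, `|g n t| <= r) ->
  (forall x y, `|x| <= r -> `|y| <= r -> c x = c y -> `|x - y| < d) ->
  (forall A : set nat, exists t,
     forall n m, A n -> ~ A m -> d <= `|g n t - g m t|) ->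
  ~ countable [set (fun n => g n t) | t in [set: K]].
Proof.
move=> gr cP /choice[t tP] /countable_injP[e e_inj].
pose S A := [set x : T | `[< exists2 n, A n & c (g n (t A)) = x >]]%SET.
(* Coding the pair by one natural number reduces the claim to Cantor's theorem. *)
apply: (@no_powerset_injection
  (fun A => choice.pickle (e (fun n => g n (t A)), S A))).
have sub A B : (fun n => g n (t A)) = (fun n => g n (t B)) -> S A = S B ->
    A `<=` B.
  move=> gAB /setP SAB n An; have gE k : g k (t A) = g k (t B).
    exact: (congr1 (fun h => h k) gAB).
  apply: contrapT => nBn.
  have : c (g n (t A)) \in S A by rewrite inE; apply/asboolP; exists n.
  rewrite SAB inE => /asboolP[m Bm]; rewrite gE => /cP /=.
  by rewrite !gr => /(_ isT isT); rewrite ltNge (tP B).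
move=> A B /(pcan_inj choice.pickleK)[/e_inj] gAB SAB.
have {}gAB := gAB (mem_set (imageT _ _)) (mem_set (imageT _ _)).
by apply/seteqP; split; apply: sub.
Qed.

(** * Points separating a set of indices from its complement *)

Lemma compact_independent (R : realType) (V : normedModType R)
    (K : topologicalType) (g : nat -> K -> V) (d : R) (A : set nat) :
  compact [set: K] -> (forall n, continuous (g n)) ->
  (forall E : {fset nat}, exists t, forall n m, n \in E -> m \in E ->
     A n -> ~ A m -> d <= `|g n t - g m t|) ->
  exists t, forall n m, A n -> ~ A m -> d <= `|g n t - g m t|.
Proof.
move=> cK cg gE; pose S (E : {fset nat}) := [set t | forall n m,
  n \in E -> m \in E -> A n -> ~ A m -> d <= `|g n t - g m t|].
have FF : ProperFilter (filter_from [set: {fset nat}] S).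
  apply: filter_from_proper => [|E _]; last exact: gE.
  apply: filter_from_filter; first by exists fset0.
  move=> E E' _ _; exists (E `|` E')%fset => // t tS.
  by split=> n m nE mE; apply: tS; rewrite inE ?nE ?mE ?orbT.
have [t [_]] := cK _ FF filterT; rewrite clusterE => tF.
exists t => n m An Am.
suff cl : closed [set t | d <= `|g n t - g m t|].
  apply: cl; apply: tF; exists [fset n; m]%fset => // u; apply=> //.
    by rewrite !inE eqxx.
  by rewrite !inE eqxx orbT.
apply: (@preimage_closed _ _ (fun t => `|g n t - g m t|) [set r | d <= r]).
  by move=> u _; apply: cvg_norm; apply: cvgB; exact: cg.
exact: closed_ge.
Qed.

(* At a point [t] where [f A] and [f B] are almost [4] apart, the values
   [f n t] for [n] in [A] and [f m t] for [m] in [B] lie in the two balls of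
   radius [D] around [f A t] and [f B t], and these are separated as [D < 2]. *)
Lemma disjoint_separated (R : realType) (V : normedModType R)
    (K : topologicalType) (D : R) (f : M -> continuousType K V)
    (A B : finpart) :
  compact [set: K] -> D < 2 ->
  (forall x y : M,
     (dist x y)%:R <= supnorm (f x \- f y) <= D * (dist x y)%:R) ->
  [disjoint val A & val B]%fset ->
  exists t, forall n m, n \in val A -> m \in val B ->
    2 - D <= `|f (Pt n) t - f (Pt m) t|.
Proof.
move=> cK D2 fP AB.
have cf x y : continuous (f x \- f y).
  by move=> t; apply: cvgB; exact: cts_fun.
have le_dist x y t : `|f x t - f y t| <= D * (dist x y)%:R.
  have /andP[_] := fP x y; apply: le_trans.
  exact: (le_supnorm t cK (cf x y)).
have dAB : dist (Fin A) (Fin B) = 4%N.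
  rewrite distE /=; case: eqP AB => [->|_].
    rewrite -fsetI_eq0 fsetIid => /eqP B0.
    by have := valP B; rewrite B0 eqxx.
  by rewrite -fsetI_eq0 => ->.
(* If [K] were empty, the supremum would be [0], below the distance [4]. *)
have [s0 s0K] : [set `|(f (Fin A) \- f (Fin B)) t| | t in [set: K]] !=set0.
  apply/set0P/eqP => K0; have := fP (Fin A) (Fin B).
  by rewrite dAB /supnorm K0 sup0 lern0.
have hs : has_sup [set `|(f (Fin A) \- f (Fin B)) t| | t in [set: K]].
  by split; [exists s0|exact: supnorm_has_ubound].
(* With slack [2 - D] in the supremum, two triangle inequalities leave
   [4 - (2 - D) - 2 * D = 2 - D]. *)
have d0 : 0 < 2 - D by rewrite subr_gt0.
have [_ [t _ <-] tAB] := sup_adherent d0 hs.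
exists t => n m nA mB.
have := le_dist (Pt n) (Fin A) t; have := le_dist (Pt m) (Fin B) t.
rewrite !distE /= nA mB mulr1.
have /andP[+ _] := fP (Fin A) (Fin B); rewrite dAB => supAB.
have {}tAB : 4 - (2 - D) < `|f (Fin A) t - f (Fin B) t|.
  by apply: le_lt_trans tAB; rewrite lerB.
have := ler_distD (f (Pt n) t) (f (Fin A) t) (f (Fin B) t).
have := ler_distD (f (Pt m) t) (f (Pt n) t) (f (Fin B) t).
rewrite (distrC (f (Fin A) t) (f (Pt n) t)).
lra.
Qed.

Theorem lemma2 (R : realType) (s : scalars) (K : topologicalType) :
  compact [set: K] -> hausdorff_space K ->
  (exists (D : R) (f : M -> continuousType K (scalar_field R s)),
     1 <= D < 2 /\
     forall x y : M,
       (dist x y)%:R <= supnorm (f x \- f y) <= D * (dist x y)%:R) ->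
  ~ scattered K.
Proof.
move=> cK hK [D [f [/andP[_ D2] fP]]] sK.
pose p (n : nat) : Defs.pnat := Sub n.+1 isT.
have p_inj : injective p by move=> n m [].
pose g n t := f (Pt (p n)) t - f Defs.Empty t.
have cg n : continuous (g n) by move=> t; apply: cvgB; exact: cts_fun.
have gD n t : `|g n t| <= D.
  have /andP[_] := fP (Pt (p n)) Defs.Empty; rewrite distE mulr1.
  exact: le_trans (le_supnorm t cK (cg n)).
have [|T [c cP]] := @scalar_cells R s D (2 - D); first by rewrite subr_gt0.
apply: (independent_uncountable_range gD cP); last first.
  exact: scattered_countable_image.
move=> A; apply: compact_independent => // E.
have gB n m t : g n t - g m t = f (Pt (p n)) t - f (Pt (p m)) t.
  by rewrite /g opprB addrA subrK.
have sep (X Y : {fset nat}) : X != fset0 -> Y != fset0 ->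
    [disjoint X & Y]%fset ->
    exists t, forall n m, n \in X -> m \in Y -> 2 - D <= `|g n t - g m t|.
  move=> X0 Y0 XY.
  have im0 (Z : {fset nat}) : Z != fset0 -> (p @` Z)%fset != fset0.
    by move=> /fset0Pn[n nZ]; apply/fset0Pn; exists (p n); exact: in_imfset.
  pose fin Z Z0 : finpart :=
    exist (fun A : {fset Defs.pnat} => A != fset0) _ (im0 Z Z0).
  have [|t tP] := disjoint_separated
    (A := fin X X0) (B := fin Y Y0) cK D2 fP.
    apply/fdisjointP => _ /imfsetP[n /= nX ->].
    by rewrite mem_imfset//; exact: (fdisjointP XY).
  by exists t => n m nX mY; rewrite gB; apply: tP; exact: in_imfset.
(* [t0] is just some point of [K], for the case where [E] lies inside [A] or inside its complement
   and the condition is vacuous. *)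
have [|||t0 _] := sep [fset 0%N]%fset [fset 1%N]%fset.
- by apply/fset0Pn; exists 0%N; rewrite inE.
- by apply/fset0Pn; exists 1%N; rewrite inE.
- by rewrite fdisjoint1X inE.
pose X := [fset n in E | `[< A n >]]%fset.
pose Y := [fset n in E | ~~ `[< A n >]]%fset.
have [X0|X0] := eqVneq X fset0; last have [Y0|Y0] := eqVneq Y fset0.
- exists t0 => n m nE _ /asboolP An; have : n \in X by rewrite !inE nE.
  by rewrite X0.
- exists t0 => n m _ mE _ /asboolPn Am; have : m \in Y by rewrite !inE mE.
  by rewrite Y0.
have [|t tP] := sep X Y X0 Y0.
  apply/fdisjointP => n; rewrite !inE => /andP[_ An].
  by rewrite negb_and An orbT.
exists t => n m nE mE /asboolP An /asboolPn Am.
by apply: tP; rewrite !inE ?nE ?mE.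
Qed.
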